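(* Consider a platoon of a leader (vehicle $0$) moving at constant speed and $N$ heterogeneous followers. For follower $i\in\{1,\dots,N\}$ let $\tau_i>0$ be its inertial time lag, $k_i=[k_{ip},k_{iv},k_{ia}]^T\in\mathbb{R}^3$ its feedback gain, and $c_p,c_v,c_a\in\{0,1\}$ the measurement indicators. Define $$t_{ip}=\tfrac{1}{\tau_i}k_{ip}c_p,\qquad t_{iv}=\tfrac{1}{\tau_i}k_{iv}c_v,\qquad t_{ia}=\tfrac{1}{\tau_i}k_{ia}c_a,$$ the diagonal matrices $\Delta=\mathrm{diag}\{1/\tau_1,\dots,1/\tau_N\}$, $T_\sharp=\mathrm{diag}\{t_{1\sharp},\dots,t_{N\sharp}\}$ for $\sharp\in\{p,v,a\}$, and $G=\mathcal{L}+\mathcal{P}$. Consider the closed-loop system of tracking errors $\hat p,\hat v,\hat a\in\mathbb{R}^N$: $$\begin{bmatrix}\dot{\hat p}\\ \dot{\hat v}\\ \dot{\hat a}\end{bmatrix}=\begin{bmatrix}0&I_N&0\\0&0&I_N\\-T_pG&-T_vG&-\Delta-T_aG\end{bmatrix}\begin{bmatrix}\hat p\\ \hat v\\ \hat a\end{bmatrix}.$$ If the information flow topology among the followers is a directed acyclic graph, then this system is asymptotically stable if and only if all of the following hold: (1) $c_p=c_v=1$; (2) $d_{ii}+p_{ii}>0$ for every $i\in\{1,\dots,N\}$; (3) for every $i\in\{1,\dots,N\}$, $$k_{ip}>0,\qquad k_{iv}>\frac{\tau_ik_{ip}}{1+k_{ia}c_a(d_{ii}+p_{ii})},\qquad 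k_{ia}c_a>-\frac{1}{d_{ii}+p_{ii}}.$$
   Context: The information flow among followers is a directed graph on $\{1,\dots,N\}$ with adjacency matrix $\mathcal{A}=[a_{ij}]$, $a_{ij}=1$ if follower $i$ receives information from follower $j$, else $0$, and $a_{ii}=0$. The degree matrix is $\mathcal{D}=\mathrm{diag}\{d_{11},\dots,d_{NN}\}$ with $d_{ii}=\sum_{k=1}^N a_{ik}$, and the Laplacian is $\mathcal{L}=\mathcal{D}-\mathcal{A}$. The pinning matrix is $\mathcal{P}=\mathrm{diag}\{p_{11},\dots,p_{NN}\}$ with $p_{ii}=1$ if follower $i$ receives information from the leader, else $0$. A directed acyclic graph is a finite directed graph with no directed cycles. (Physically, $\hat p_i=p_i-p_0+id_0$, $\hat v_i=v_i-v_0$, $\hat a_i=a_i$ are the tracking errors of follower $i$ with dynamics $\dot p_i=v_i$, $\dot v_i=a_i$, $\tau_i\dot a_i+a_i=u_i$ under the controller $u_i=-k_i^T(\sum_j a_{ij}(\hat y_i-\hat y_j)+p_{ii}\hat y_i)$, $\hat y_i=\mathrm{diag}\{c_p,c_v,c_a\}[\hat p_i,\hat v_i,\hat a_i]^T$.) *)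

(* Defs.v *)
From HB Require Import structures.
From mathcomp Require Import all_boot all_order all_algebra.
From mathcomp Require Import all_classical all_reals all_analysis.
Set Implicit Arguments. Unset Strict Implicit. Unset Printing Implicit Defensive.
Import Order.TTheory GRing.Theory Num.Theory.
Import numFieldNormedType.Exports.
Local Open Scope ring_scope.
Local Open Scope classical_set_scope.

Section Platoon.
Variable R : realType.
Variable N : nat.

(* Information flow among followers: adj i j = true iff a_ij = 1,
   i.e. follower i receives information from follower j. *)
Definition adj_mx (adj : 'I_N -> 'I_N -> bool) : 'M[R]_N :=
  \matrix_(i, j) (adj i j)%:R.

Definition deg (adj : 'I_N -> 'I_N -> bool) (i : 'I_N) : R :=
  \sum_(k < N) (adj i k)%:R.

Definition deg_mx (adj : 'I_N -> 'I_N -> bool) : 'M[R]_N :=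
  diag_mx (\row_i deg adj i).

Definition laplacian (adj : 'I_N -> 'I_N -> bool) : 'M[R]_N :=
  deg_mx adj - adj_mx adj.

(* pin i = true iff p_ii = 1 (follower i receives info from the leader) *)
Definition pin_mx (pin : 'I_N -> bool) : 'M[R]_N :=
  diag_mx (\row_i ((pin i)%:R : R)).

Definition Gmx (adj : 'I_N -> 'I_N -> bool) (pin : 'I_N -> bool) : 'M[R]_N :=
  laplacian adj + pin_mx pin.

Definition Tmx (tau k : 'I_N -> R) (c : bool) : 'M[R]_N :=
  diag_mx (\row_i ((tau i)^-1 * k i * (c%:R : R))).

Definition Delta_mx (tau : 'I_N -> R) : 'M[R]_N :=
  diag_mx (\row_i (tau i)^-1).

Definition platoon_mx (adj : 'I_N -> 'I_N -> bool) (pin : 'I_N -> bool)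
  (tau kp kv ka : 'I_N -> R) (cp cv ca : bool) : 'M[R]_(N + (N + N)) :=
  let G := Gmx adj pin in
  col_mx (row_mx 0 (row_mx 1%:M 0))
   (col_mx (row_mx 0 (row_mx 0 1%:M))
     (row_mx (- (Tmx tau kp cp *m G))
       (row_mx (- (Tmx tau kv cv *m G)) (- Delta_mx tau - Tmx tau ka ca *m G)))).

End Platoon.

Definition dag (N : nat) (adj : 'I_N -> 'I_N -> bool) : Prop :=
  forall i j : 'I_N, adj i j -> ~~ connect (fun x y => adj x y) j i.

Definition is_solution (R : realType) (n : nat) (A : 'M[R]_n)
  (x : R -> 'cV[R]_n) : Prop :=
  forall (t : R) (k : 'I_n),
    is_derive t (1 : R) (fun s => x s k ord0) ((A *m x t) k ord0).

Definition asympt_stable (R : realType) (n : nat) (A : 'M[R]_n) : Prop :=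
  (forall eps : R, 0 < eps -> exists2 delta : R, 0 < delta &
     forall x, is_solution A x -> (forall k, `|x 0 k ord0| < delta) ->
       forall t : R, 0 <= t -> forall k, `|x t k ord0| < eps)
  /\
  (forall x, is_solution A x -> forall k,
     (fun t => x t k ord0) @ +oo --> (0 : R)).

(* Main.v *)
Require Import Defs.
From HB Require Import structures.
From mathcomp Require Import all_boot all_order all_algebra.
From mathcomp Require Import all_classical all_reals all_analysis.
From mathcomp Require Import ring lra.
From mathcomp Require Import complex.
Import Order.TTheory GRing.Theory Num.Theory.
Import numFieldNormedType.Exports.
Set Implicit Arguments. Unset Strict Implicit. Unset Printing Implicit Defensive.
Local Open Scope ring_scope.
Local Open Scope complex_scope.

(* With g_i = d_ii + p_ii, acyclicity makes the closed loop a cascade whose i-th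
   block has characteristic polynomial
     s^3 + (1/tau_i + t_ia g_i) s^2 + t_iv g_i s + t_ip g_i,
   and conditions (1)-(3) are the Routh-Hurwitz conditions 0 < a, 0 < c, c < ab
   for all these cubics s^3 + a s^2 + b s + c.
   Necessity: every complex root of a block is an eigenvalue of the whole matrix,
   and an eigenvalue l with eigenvector v gives the real solutions Re (w e^(lt) v);
   if they all vanish at infinity then Re l < 0.
   Sufficiency: each block has a quadratic Lyapunov function with an error term
   quadratic in the input from its predecessors. Summing these with weights growing
   geometrically along the graph absorbs the error terms, so that a single quadratic
   form decays exponentially along every solution. *)

(** * Real cubics: root locations and the Routh-Hurwitz inequalities *)

Lemma cubic_real_root (R : rcfType) (a b c : R) :
  exists r : R, r ^+ 3 + a * r ^+ 2 + b * r + c = 0.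
Proof.
pose p : {poly R} := 'X^3 + a *: 'X^2 + b *: 'X + c%:P.
have pE x : p.[x] = x ^+ 3 + a * x ^+ 2 + b * x + c by rewrite !hornerE.
(* At [B] and [- B] the leading term dominates: since [B >= 1], [B ^+ 3] exceeds the sum of |a| B^2,
   |b| B and |c|, so the cubic changes sign in between. *)
pose B : R := 1 + `|a| + `|b| + `|c|.
have [a1 b1 c1] : [/\ -`|a| <= a <= `|a|, -`|b| <= b <= `|b| & -`|c| <= c <= `|c|].
  by rewrite -!ler_norml !lexx.
have [a0 b0 c0] : [/\ 0 <= `|a|, 0 <= `|b| & 0 <= `|c|] by rewrite !normr_ge0.
have B1 : 1 <= B by rewrite /B; lra.
have B2 : B <= B ^+ 2 by rewrite expr2; nra.
have B20 : 1 <= B ^+ 2 by lra.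
have BE : B ^+ 3 = B ^+ 2 + `|a| * B ^+ 2 + `|b| * B ^+ 2 + `|c| * B ^+ 2.
  by rewrite /B; ring.
have [x _ /rootP] : exists2 x, -B <= x <= B & root p x.
  apply: poly_ivt; first by lra.
  rewrite !pE exprNn sqrrN; apply/andP; split.
    have -> : (-1) ^+ 3 * B ^+ 3 = - B ^+ 3 by ring.
    rewrite BE; nra.
  rewrite BE; nra.
by rewrite pE => px; exists x.
Qed.

(** Dividing by a real root r leaves z^2 + m z + n, with a = m - r, b = n - r m, c = - r n. The
    hypothesis gives r < 0 and, at a root of the quadratic, m, n > 0; then a b - c = m (n - r m +
    r^2) > 0. *)
Lemma hurwitz_of_roots (R : rcfType) (a b c : R) :
  (forall z : R[i], z ^+ 3 + a%:C * z ^+ 2 + b%:C * z + c%:C = 0 ->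
     complex.Re z < 0) ->
  [/\ 0 < a, 0 < c & c < a * b].
Proof.
move=> H.
have [r r0] := cubic_real_root a b c.
pose m := a + r; pose n := b + r * m.
have bE : b = n - r * m by rewrite /n; ring.
have aE : a = m - r by rewrite /m; ring.
have cE : c = - r * n.
  by rewrite /n /m; lra.
have rN : r < 0.
  apply: (H r%:C).
  by rewrite -!rmorphXn -!rmorphM -!rmorphD/= r0.
have quad (z : R[i]) : z ^+ 2 + m%:C * z + n%:C = 0 -> complex.Re z < 0.
  move=> zE; apply: H; rewrite aE bE cE.
  rewrite !(rmorphB, rmorphM, rmorphN)/=.
  transitivity ((z - r%:C) * (z ^+ 2 + m%:C * z + n%:C)); first ring.
  by rewrite zE mulr0.
have [mP nP] : 0 < m /\ 0 < n.
  (* If the roots are real, the larger one (s - m) / 2 is negative, so 0 <= s < m and m^2 - 4 n <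
     m^2. Otherwise the real part - m / 2 is negative, and 4 n > m^2. *)
  have [D0|D0] := leP 0 (m ^+ 2 - 4 * n).
    pose s := Num.sqrt (m ^+ 2 - 4 * n).
    have s2 : s ^+ 2 = m ^+ 2 - 4 * n by rewrite sqr_sqrtr.
    have s0 : 0 <= s by exact: sqrtr_ge0.
    have /= : complex.Re ((s - m) / 2)%:C < 0.
      apply: quad; rewrite -!rmorphXn -!rmorphM -!rmorphD/=.
      have -> : ((s - m) / 2) ^+ 2 + m * ((s - m) / 2) + n = 0 by field: s2.
      by [].
    move=> sm; have sm' : s < m by lra.
    split; first lra.
    have : s ^+ 2 < m ^+ 2 by nra.
    lra.
  pose s := Num.sqrt (4 * n - m ^+ 2).
  have s2 : s ^+ 2 = 4 * n - m ^+ 2 by rewrite sqr_sqrtr//; lra.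
  have m0 : complex.Re (Complex (- m / 2) (s / 2)) < 0.
    apply: quad; apply/eqP; rewrite eq_complex expr2 /=.
    apply/andP; split; apply/eqP; last by field.
    by field: s2.
  rewrite /= in m0.
  have mP : 0 < m by lra.
  by split => //; nra.
rewrite aE bE cE; split; [lra|nra|].
have -> : (m - r) * (n - r * m) = - r * n + m * (n - r * m + r ^+ 2) by ring.
by have := sqr_ge0 r; nra.
Qed.

(** * Quadratic Lyapunov functions for a single block *)

(* For x' = y, y' = z, z' = - c x - b y - a z + u: at e = 0 the derivative of this
   form is only - 2 (a b - c) y^2 when u = 0; the term in e makes it negative
   definite. [dlyap] is the derivative along this flow. *)
Definition lyap (R : pzRingType) (a b c e x y z : R) : R :=
  z ^+ 2 + 2 * a * y * z + (b + a ^+ 2) * y ^+ 2 + 2 * c * x * y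
  + a * c * x ^+ 2 + e * (c * x * z - a ^+ 2 * y * z).

Definition dlyap (R : pzRingType) (a b c e x y z u : R) : R :=
  - 2 * (a * b - c) * y ^+ 2
  + e * (c * (y * z - c * x ^+ 2 - b * x * y - a * x * z)
       + a ^+ 2 * (- z ^+ 2 + c * x * y + b * y ^+ 2 + a * y * z))
  + u * (2 * z + 2 * a * y + e * (c * x - a ^+ 2 * y)).

Section is_derive_fun.
Variables (R : realType) (t : R).
Implicit Types f g : R -> R.

Lemma is_derive_addf f g df dg : is_derive t (1 : R) f df ->
  is_derive t (1 : R) g dg -> is_derive t (1 : R) (fun s => f s + g s) (df + dg).
Proof. by move=> hf hg; exact: (is_deriveD hf hg). Qed.

Lemma is_derive_mulf f g df dg : is_derive t (1 : R) f df ->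
  is_derive t (1 : R) g dg ->
  is_derive t (1 : R) (fun s => f s * g s) (df * g t + f t * dg).
Proof.
by move=> hf hg; apply: (is_derive_eq (is_deriveM hf hg)); rewrite addrC mulrC.
Qed.

Lemma is_derive_mulc (k : R) f df : is_derive t (1 : R) f df ->
  is_derive t (1 : R) (fun s => k * f s) (k * df).
Proof. by move=> hf; exact: (is_deriveZ k hf). Qed.

End is_derive_fun.

Lemma is_derive_lyap (R : realType) (a b c e : R) (x y z : R -> R) (t u : R) :
  is_derive t (1 : R) x (y t) -> is_derive t (1 : R) y (z t) ->
  is_derive t (1 : R) z (- c * x t - b * y t - a * z t + u) ->
  is_derive t (1 : R) (fun s => lyap a b c e (x s) (y s) (z s))
    (dlyap a b c e (x t) (y t) (z t) u).
Proof.
move=> dx dy dz.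
have -> : (fun s => lyap a b c e (x s) (y s) (z s)) = fun s =>
    z s * z s + (2 * a) * (y s * z s) + (b + a ^+ 2) * (y s * y s)
    + (2 * c) * (x s * y s) + (a * c) * (x s * x s)
    + (e * c) * (x s * z s) + (- (e * a ^+ 2)) * (y s * z s).
  by apply/funext => s; rewrite /lyap; ring.
pose M2 (k : R) f g df dg hf hg :=
  is_derive_mulc k (@is_derive_mulf R t f g df dg hf hg).
have := is_derive_addf (is_derive_addf (is_derive_addf (is_derive_addf (is_derive_addf
  (is_derive_addf (is_derive_mulf dz dz) (M2 (2 * a) _ _ _ _ dy dz))
  (M2 (b + a ^+ 2) _ _ _ _ dy dy)) (M2 (2 * c) _ _ _ _ dx dy))
  (M2 (a * c) _ _ _ _ dx dx)) (M2 (e * c) _ _ _ _ dx dz))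
  (M2 (- (e * a ^+ 2)) _ _ _ _ dy dz).
by move=> h; apply: (is_derive_eq h); rewrite /dlyap; ring.
Qed.

Lemma young (R : realFieldType) (k p q : R) : 0 < k ->
  p * q <= k * p ^+ 2 + q ^+ 2 / (4 * k).
Proof.
move=> k0; rewrite -subr_ge0.
have -> : k * p ^+ 2 + q ^+ 2 / (4 * k) - p * q = k * (p - q / (2 * k)) ^+ 2.
  by field; lra.
by rewrite mulr_ge0 ?sqr_ge0// ltW.
Qed.

(** Completing squares turns the form into (z + a y)^2 + (c / a) (y + a x)^2 + ((a b - c) / a)
    y^2. *)
Lemma lyap0_lower (R : realFieldType) (a b c : R) : 0 < a -> 0 < c -> c < a * b ->
  exists2 m, 0 < m & forall x y z,
    m * (x ^+ 2 + y ^+ 2 + z ^+ 2) <= lyap a b c 0 x y z.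
Proof.
move=> a0 c0 abc; have d0 : 0 < a * b - c by rewrite subr_gt0.
(* x^2 + y^2 + z^2 is at most 2 A + (2 / a^2) B + (2 a^2 + 2 / a^2 + 1) C for the three squares A,
   B, C below; [M] adds up the ratios of these coefficients to 1, c / a and (a b - c) / a. *)
pose M := 2 + 2 / (a * c) + (2 * a ^+ 2 + 2 / a ^+ 2 + 1) * (a / (a * b - c)).
have [M1 M2 M3] : [/\ 0 < 2 / (a * c), 0 < 2 * a ^+ 2 + 2 / a ^+ 2 + 1
    & 0 < a / (a * b - c)].
  by split; rewrite ?divr_gt0 ?mulr_gt0// !addr_gt0 ?divr_gt0 ?mulr_gt0 ?exprn_gt0.
have M4 := mulr_gt0 M2 M3.
have M0 : 0 < M by rewrite /M; lra.
exists M^-1; first by rewrite invr_gt0.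
move=> x y z; rewrite mulrC ler_pdivrMr//.
pose A := (z + a * y) ^+ 2; pose B := (y + a * x) ^+ 2; pose C := y ^+ 2.
have [A0 B0 C0] : [/\ 0 <= A, 0 <= B & 0 <= C] by rewrite !sqr_ge0.
have -> : lyap a b c 0 x y z = A + c / a * B + (a * b - c) / a * C.
  by rewrite /lyap /A /B /C; field; lra.
have ca0 : 0 <= c / a * B by rewrite mulr_ge0// divr_ge0// ltW.
have da0 : 0 <= (a * b - c) / a * C by rewrite mulr_ge0// divr_ge0// ltW.
have zle : z ^+ 2 <= 2 * A + 2 * a ^+ 2 * C.
  by rewrite /A /C; have := sqr_ge0 (z + 2 * a * y); lra.
have xle : x ^+ 2 <= 2 / a ^+ 2 * B + 2 / a ^+ 2 * C.
  rewrite -subr_ge0.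
  have -> : 2 / a ^+ 2 * B + 2 / a ^+ 2 * C - x ^+ 2 = ((a * x + 2 * y) / a) ^+ 2.
    by rewrite /B /C; field; lra.
  exact: sqr_ge0.
have E : (c / a * B) * (2 / (a * c)) = 2 / a ^+ 2 * B by field; lra.
have F : ((a * b - c) / a * C) * ((2 * a ^+ 2 + 2 / a ^+ 2 + 1) * (a / (a * b - c)))
  = (2 * a ^+ 2 + 2 / a ^+ 2 + 1) * C by field; lra.
set P := c / a * B in ca0 E *; set Q := _ / a * C in da0 F *.
rewrite /M.
set u := 2 / (a * c) in E M1 *; set v := _ * (a / _) in F M4 *.
have -> : (A + P + Q) * (2 + u + v) = 2 * A + A * u + A * v + 2 * P + P * u + P * v
  + 2 * Q + Q * u + Q * v by ring.
rewrite E F.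
have [] : [/\ 0 <= A * u, 0 <= A * v, 0 <= P * v & 0 <= Q * u].
  by split; rewrite mulr_ge0// ltW.
rewrite -/C; lra.
Qed.

(** Every cross term obeys 2 |p q| <= p^2 + q^2 <= S. The lower bound is relative to the form at e =
    0, so positivity survives for small e. *)
Lemma lyap_bounds (R : realFieldType) (a b c e : R) (x y z : R) :
    0 < a -> 0 < b -> 0 < c -> 0 <= e ->
  let S := x ^+ 2 + y ^+ 2 + z ^+ 2 in
  lyap a b c 0 x y z - e * (c + a ^+ 2) * S <= lyap a b c e x y z
    <= (1 + a + b + a ^+ 2 + 2 * c + a * c + e * (c + a ^+ 2)) * S.
Proof.
move=> a0 b0 c0 e0 /=; set S := x ^+ 2 + y ^+ 2 + z ^+ 2.
have [ac0 a20] : 0 <= a * c /\ 0 <= a ^+ 2 by rewrite mulr_ge0 ?exprn_ge0 ?ltW.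
have ec : 0 <= e * c by rewrite mulr_ge0// ltW.
have ea : 0 <= e * a ^+ 2 by rewrite mulr_ge0.
have [X Y Z] : [/\ 0 <= x ^+ 2, 0 <= y ^+ 2 & 0 <= z ^+ 2] by rewrite !sqr_ge0.
have P (k p q r : R) : 0 <= k -> 0 <= r -> r + p ^+ 2 + q ^+ 2 = S ->
    - (k * S) <= k * (2 * p * q) <= k * S.
  move=> k0 r0 <-; rewrite -mulrN !ler_wpM2l//.
    by have := sqr_ge0 (p - q); lra.
  by have := sqr_ge0 (p + q); lra.
have E1 : z ^+ 2 + x ^+ 2 + y ^+ 2 = S by rewrite /S; ring.
have E2 : y ^+ 2 + x ^+ 2 + z ^+ 2 = S by rewrite /S; ring.
have E3 : x ^+ 2 + y ^+ 2 + z ^+ 2 = S by rewrite /S; ring.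
have /andP[_ H1] := P _ _ _ _ (ltW a0) X E3.
have /andP[_ H2] := P _ _ _ _ (ltW c0) Z E1.
have /andP[H3 H4] := P _ _ _ _ ec Y E2.
have /andP[H5 H6] := P _ _ _ _ ea X E3.
have Q (k p : R) : 0 <= k -> p <= S -> k * p <= k * S.
  by move=> k0 r0; rewrite ler_wpM2l.
have H7 : z ^+ 2 <= S by rewrite /S; lra.
have H8 : a * c * x ^+ 2 <= a * c * S by apply: Q; rewrite /S//; lra.
have H9 : b * y ^+ 2 <= b * S by apply: Q; rewrite /S//; lra.
have H10 : a ^+ 2 * y ^+ 2 <= a ^+ 2 * S by apply: Q; rewrite /S//; lra.
have S0 : 0 <= S by rewrite /S; lra.
have S1 := mulr_ge0 ec S0.
have S2 := mulr_ge0 ea S0.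
have S3 := mulr_ge0 (ltW c0) S0.
have S4 := mulr_ge0 (ltW a0) S0.
have S5 := mulr_ge0 (ltW b0) S0.
clear -H1 H2 H3 H4 H5 H6 H7 H8 H9 H10 S0 S1 S2 S3.
rewrite /lyap; move: S H1 H2 H3 H4 H5 H6 H7 H8 H9 H10 S0 S1 S2 S3 => S *.
by apply/andP; split; lra.
Qed.

(** The terms in e supply - e c^2 x^2 and - e a^2 z^2. Absorbing the cross terms into squares costs
    a multiple of e y^2, which half of 2 (a b - c) y^2 pays for when e is small. *)
Lemma dlyap_upper (R : realFieldType) (a b c e : R) (x y z u : R) :
    0 < a -> 0 < c -> 0 <= e ->
    e * ((a ^+ 2 - b) ^+ 2 + (c + a ^+ 3) ^+ 2 / a ^+ 2 + a ^+ 2 * b) <= a * b - c ->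
  dlyap a b c e x y z 0 <= - (e * c ^+ 2 / 4) * x ^+ 2 - (a * b - c) * y ^+ 2
    - (e * a ^+ 2 / 4) * z ^+ 2.
Proof.
move=> a0 c0 e0 He; rewrite -subr_ge0.
set G := _ + _ in He.
have -> : - (e * c ^+ 2 / 4) * x ^+ 2 - (a * b - c) * y ^+ 2 - (e * a ^+ 2 / 4) * z ^+ 2
   - dlyap a b c e x y z 0 = (a * b - c - e * G) * y ^+ 2
   + e * ((c * x + a * z) ^+ 2 / 2 + (c * x / 2 - (a ^+ 2 - b) * y) ^+ 2
     + (a * z / 2 - (c + a ^+ 3) / a * y) ^+ 2).
  by rewrite /dlyap /G; field; lra.
by rewrite addr_ge0// mulr_ge0 ?subr_ge0 ?sqr_ge0// !addr_ge0 ?sqr_ge0// divr_ge0// sqr_ge0.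
Qed.

Lemma lyap_exists (R : realFieldType) (a b c : R) :
    0 < a -> 0 < c -> c < a * b ->
  exists e m M al K : R, [/\ 0 < m, 0 <= M, 0 < al, 0 <= K & forall x y z u,
   let S := x ^+ 2 + y ^+ 2 + z ^+ 2 in
   [/\ m * S <= lyap a b c e x y z, lyap a b c e x y z <= M * S &
       dlyap a b c e x y z u <= - al * S + K * u ^+ 2]].
Proof.
move=> a0 c0 abc.
have b0 : 0 < b by rewrite -(pmulr_rgt0 _ a0) (lt_trans c0).
have d0 : 0 < a * b - c by rewrite subr_gt0.
have [m m0 Hm] := lyap0_lower a0 c0 abc.
pose G := (a ^+ 2 - b) ^+ 2 + (c + a ^+ 3) ^+ 2 / a ^+ 2 + a ^+ 2 * b.
have G0 : 0 < G.
  rewrite ltr_wpDl ?addr_ge0 ?sqr_ge0// ?divr_ge0 ?sqr_ge0//.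
  by rewrite mulr_gt0// exprn_gt0.
have k0 : 0 < c + a ^+ 2 by rewrite addr_gt0// exprn_gt0.
(* The first bound keeps half of the lower bound [m], the second is the smallness required by
   [dlyap_upper]. *)
pose e := Num.min (m / 2 / (c + a ^+ 2)) ((a * b - c) / G).
have e0 : 0 < e by rewrite lt_min !divr_gt0.
have e1 : e * (c + a ^+ 2) <= m / 2 by rewrite -ler_pdivlMr// ge_min lexx.
have e2 : e * G <= a * b - c by rewrite -ler_pdivlMr// ge_min lexx orbT.
pose al := Num.min (a * b - c) (Num.min (e * c ^+ 2 / 4) (e * a ^+ 2 / 4)).
have al0 : 0 < al by rewrite !lt_min d0 !divr_gt0// mulr_gt0// exprn_gt0.
(* The input u multiplies 2 z + ly y + e c x in [dlyap]. Young's inequality with weight [al / 2] on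
   each product uses up half of the decay and leaves the stated multiple of u^2. *)
pose ly := 2 * a - e * a ^+ 2.
exists e, (m / 2), (1 + a + b + a ^+ 2 + 2 * c + a * c + e * (c + a ^+ 2)), (al / 2),
  ((4 + ly ^+ 2 + (e * c) ^+ 2) / (4 * (al / 2))).
split; [lra| |lra| |].
- by rewrite !addr_ge0 ?mulr_ge0 ?sqr_ge0 ?ltW.
- by rewrite divr_ge0 ?mulr_ge0 ?addr_ge0 ?sqr_ge0 ?ltW// divr_gt0.
move=> x y z u S.
have [X Y Z] : [/\ 0 <= x ^+ 2, 0 <= y ^+ 2 & 0 <= z ^+ 2] by rewrite !sqr_ge0.
have S0 : 0 <= S by rewrite /S; lra.
have /andP[L U] := lyap_bounds x y z a0 b0 c0 (ltW e0).
split => //.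
  apply: le_trans L; have := Hm x y z; rewrite -/S.
  have := ler_wpM2r S0 e1; lra.
have D := @dlyap_upper R a b c e x y z u a0 c0 (ltW e0) e2.
have al2 : 0 < al / 2 by lra.
have Yx := young x (e * c * u) al2.
have Yy := young y (ly * u) al2.
have Yz := young z (2 * u) al2.
have -> : dlyap a b c e x y z u =
  dlyap a b c e x y z 0 + (x * (e * c * u) + y * (ly * u) + z * (2 * u)).
  by rewrite /dlyap /ly; ring.
have h1 : al * x ^+ 2 <= e * c ^+ 2 / 4 * x ^+ 2.
  by rewrite ler_wpM2r// !ge_min lexx ?orbT.
have h2 : al * y ^+ 2 <= (a * b - c) * y ^+ 2 by rewrite ler_wpM2r// !ge_min lexx ?orbT.
have h3 : al * z ^+ 2 <= e * a ^+ 2 / 4 * z ^+ 2.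
  by rewrite ler_wpM2r// !ge_min lexx ?orbT.
have -> : (4 + ly ^+ 2 + (e * c) ^+ 2) / (4 * (al / 2)) * u ^+ 2 =
  (e * c * u) ^+ 2 / (4 * (al / 2)) + (ly * u) ^+ 2 / (4 * (al / 2))
  + (2 * u) ^+ 2 / (4 * (al / 2)) by field; lra.
rewrite /S; lra.
Qed.

(** * From a differential inequality to asymptotic stability *)

Lemma gronwall_le0 (R : realType) (beta : R) (V dV : R -> R) :
    (forall t, is_derive t (1 : R) V (dV t)) -> (forall t, dV t <= - beta * V t) ->
  forall t, 0 <= t -> V t <= V 0 * expR (- (beta * t)).
Proof.
move=> HV le_dV t t0.
have dE (s : R) : is_derive s (1 : R) (fun r => expR (beta * r)) (beta * expR (beta * s)).
  apply: (is_derive_eq (is_derive1_comp (is_derive_expR (beta * s))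
    (is_derive_mulc beta (is_derive_id s (1 : R))))).
  by rewrite mulr1 mulrC.
(* With this integrating factor, the differential inequality says that [F] is nonincreasing. *)
pose F s := expR (beta * s) * V s.
have dF s := is_derive_mulf (dE s) (HV s).
have F_nincr : F t <= F 0.
  apply: (@ler0_derive1_nincr R F 0 t) => // [s _|].
  - rewrite derive1E; have [_ ->] := dF s.
    have -> : beta * expR (beta * s) * V s + expR (beta * s) * dV s
      = expR (beta * s) * (beta * V s + dV s) by ring.
    by rewrite pmulr_rle0 ?expR_gt0//; have := le_dV s; lra.
  - apply: continuous_subspaceT => s; apply/differentiable_continuous/derivable1_diffP.
    by have [] := dF s.
move: F_nincr; rewrite /F mulr0 expR0 mul1r expRN => F_nincr.
by rewrite ler_pdivlMr ?expR_gt0// mulrC.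
Qed.

Lemma asympt_stable_exp (R : realType) (n : nat) (A : 'M[R]_n) (C beta : R) :
    0 < C -> 0 < beta ->
    (forall x, is_solution A x -> forall t, 0 <= t -> forall k,
      x t k ord0 ^+ 2 <= C * (\sum_j x 0 j ord0 ^+ 2) * expR (- (beta * t))) ->
  asympt_stable A.
Proof.
move=> C0 beta0 H; split.
  move=> eps eps0.
  have Cn0 : 0 < C * n.+1%:R by rewrite mulr_gt0.
  (* The n squares below delta^2 sum to at most n / (n + 1) of eps^2 / C; [n.+1] makes the final
     bound strict and avoids division by 0 when n = 0. *)
  exists (Num.sqrt (eps ^+ 2 / (C * n.+1%:R))).
    by rewrite sqrtr_gt0 divr_gt0// exprn_gt0.
  move=> x solx xlt t t0 k.
  rewrite -(ltr_pXn2r (n := 2))// ?nnegrE ?(ltW eps0)// real_normK ?num_real//.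
  apply: le_lt_trans (H x solx t t0 k) _.
  have S0 : 0 <= \sum_j x 0 j ord0 ^+ 2 by apply: sumr_ge0 => j _; exact: sqr_ge0.
  apply: (@le_lt_trans _ _ (C * \sum_j x 0 j ord0 ^+ 2)).
    rewrite ler_piMr// ?mulr_ge0 ?(ltW C0)// -expR0 ler_expR oppr_le0.
    by rewrite mulr_ge0// ltW.
  rewrite mulrC -ltr_pdivlMr//.
  apply: (@le_lt_trans _ _ (\sum_(j < n) (eps ^+ 2 / (C * n.+1%:R)))).
    apply: ler_sum => j _; have := xlt j.
    rewrite -(ltr_pXn2r (n := 2))// ?nnegrE ?sqrtr_ge0//.
    rewrite real_normK ?num_real// sqr_sqrtr; first exact: ltW.
    by rewrite divr_ge0 ?sqr_ge0// ltW.
  rewrite sumr_const card_ord -[ltLHS]mulr_natr invfM mulrA -mulrA.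
  rewrite gtr_pMr ?divr_gt0 ?exprn_gt0// mulrC ltr_pdivrMr// mul1r.
  by rewrite ltr_nat.
move=> x solx k.
have lim0 : ((fun t => (x t k ord0) ^+ 2) @ +oo --> (0 : R))%classic.
  apply: (@squeeze_cvgr _ _ _ _ (cst 0)
    (fun t => C * (\sum_j x 0 j ord0 ^+ 2) * expR (- (beta * t)))).
  - near=> t; rewrite sqr_ge0 /=; apply: H => //.
  - exact: cvg_cst.
  - rewrite -[X in (_ --> X)%classic](mulr0 (C * (\sum_j x 0 j ord0 ^+ 2))).
    apply: cvgMl_tmp; apply: (cvg_comp _ _ _ (@cvgr_expR R)).
    by apply: gt0_cvgMry => //; exact: cvg_id.
apply/cvgr0Pnorm_lt => e e0.
have e20 : 0 < e ^+ 2 by rewrite exprn_gt0.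
move/cvgr_lt : lim0 => /(_ _ e20); apply: filterS => t.
rewrite -[X in X < _]real_normK ?num_real//.
by rewrite ltr_pXn2r// ?nnegrE// ltW.
Unshelve. all: by end_near. Qed.

(** * Solutions attached to complex eigenvalues *)

Definition cexp (R : realType) (l : R[i]) (t : R) : R[i] :=
  Complex (expR (complex.Re l * t) * cos (complex.Im l * t))
          (expR (complex.Re l * t) * sin (complex.Im l * t)).

Lemma is_derive_cexp (R : realType) (l c : R[i]) (t : R) :
  is_derive t (1 : R) (fun s => complex.Re (cexp l s * c))
    (complex.Re (cexp l t * (l * c))).
Proof.
case: l c => sg om [p q].
have lin (k : R) : is_derive t (1 : R) (fun s : R => k * s) k.
  by apply: (is_derive_eq (is_derive_mulc k (is_derive_id t (1 : R)))); rewrite mulr1.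
have dE := is_derive1_comp (is_derive_expR (sg * t)) (lin sg).
have dC := is_derive1_comp (is_derive_cos (om * t)) (lin om).
have dS := is_derive1_comp (is_derive_sin (om * t)) (lin om).
have := is_derive_addf (is_derive_mulf dE (is_derive_mulc p dC))
  (is_derive_mulf dE (is_derive_mulc (- q) dS)).
have -> : (fun s : R => (expR \o (fun r => sg * r)) s * (p * (cos \o (fun r => om * r)) s)
   + (expR \o (fun r => sg * r)) s * (- q * (sin \o (fun r => om * r)) s))
   = fun s => complex.Re (cexp (Complex sg om) s * Complex p q).
  by apply/funext => s /=; ring.
by move=> h; apply: (is_derive_eq h); rewrite /=; ring.
Qed.

(** If Re l >= 0, the modulus of e^(lt) v_k never falls below |v_k| for t >= 0, while its real and
    imaginary parts must both tend to 0. *)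
Lemma eigenvalue_Re_lt0 (R : realType) (n : nat) (A : 'M[R]_n) (l : R[i])
    (v : 'I_n -> R[i]) :
    (forall x, is_solution A x -> forall k,
      ((fun t => x t k ord0) @ +oo --> (0 : R))%classic) ->
    (forall k, \sum_j (A k j)%:C * v j = l * v k) ->
    (exists k, v k != 0) ->
  complex.Re l < 0.
Proof.
move=> attr Av [k vk0]; rewrite ltNge; apply/negP => l0.
(* The free factor [w] yields real parts at w = 1 and imaginary parts at w = - i from one family of
   real solutions. *)
have lim (w : R[i]) : ((fun t => complex.Re (cexp l t * (w * v k))) @ +oo --> (0 : R))%classic.
  pose x t : 'cV[R]_n := \col_j complex.Re (cexp l t * (w * v j)).
  have solx : is_solution A x.
    move=> t j; rewrite mxE.
    have -> : (fun s => x s j ord0) = fun s => complex.Re (cexp l s * (w * v j)).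
      by apply/funext => s; rewrite mxE.
    apply: (is_derive_eq (is_derive_cexp l (w * v j) t)).
    have -> : l * (w * v j) = w * (l * v j) by ring.
    have ReD : {morph @complex.Re R : y z / y + z} by move=> [? ?] [? ?].
    rewrite -Av !mulr_sumr (big_morph _ ReD (erefl : complex.Re (0 : R[i]) = 0)).
    apply: eq_bigr => i _.
    rewrite mxE.
    have -> : cexp l t * (w * ((A j i)%:C * v i)) = (A j i)%:C * (cexp l t * (w * v i)).
      by ring.
    by case: (_ * (w * v i)) => p q /=; rewrite mul0r subr0.
  by have := attr x solx k; under eq_fun do rewrite mxE.
(* The two solutions are Re and Im of e^(lt) v_k, whose squares add up to
   e^(2 t Re l) |v_k|^2. *)
have lim2 : ((fun t => complex.Re (cexp l t * (1 * v k)) ^+ 2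
    + complex.Re (cexp l t * (- 'i * v k)) ^+ 2) @ +oo --> (0 : R))%classic.
  rewrite -[X in (_ --> X)%classic](_ : 0 * 0 + 0 * 0 = 0 :> R); last by ring.
  by apply: cvgD; apply: cvgM; exact: lim.
pose r := complex.Re (v k) ^+ 2 + complex.Im (v k) ^+ 2.
have r0 : 0 < r.
  move: vk0; rewrite /r; case: (v k) => p q; rewrite eq_complex /= negb_and.
  by move=> /orP[] h; [rewrite ltr_pwDl|rewrite ltr_wpDl]; rewrite ?sqr_ge0 ?exprn_even_gt0.
move/cvgr_lt : lim2 => /(_ _ r0) H.
have [t [] /=] := filter_ex (filterI H (nbhs_pinfty_ge (num_real (0 : R)))).
set F := (X in X < _) => Flt t0; move: Flt; rewrite ltNge => /negP; apply.
have -> : F = expR (complex.Re l * t) ^+ 2 * r.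
  rewrite /F /r; case: (v k) => p q /=.
  have := cos2Dsin2 (complex.Im l * t).
  move: (expR _) (cos _) (sin _) => E C S CS.
  by transitivity ((C ^+ 2 + S ^+ 2) * (E ^+ 2 * (p ^+ 2 + q ^+ 2))); [ring|rewrite CS mul1r].
by rewrite ler_peMl ?(ltW r0)// exprn_ege1// -expR0 ler_expR mulr_ge0.
Qed.

(** * Kernel vectors and weights on acyclic graphs *)

(* Restricted to the nodes with a path to [i] (the identity being put elsewhere),
   [M] has a zero row [i]; a kernel vector of this restriction, which vanishes
   off these nodes, is also one of [M]. *)
Lemma dag_kernel (F : fieldType) (N : nat) (adj : 'I_N -> 'I_N -> bool)
    (M : 'M[F]_N) (i : 'I_N) :
    dag adj -> (forall k j, k != j -> ~~ adj k j -> M k j = 0) -> M i i = 0 ->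
  exists2 y : 'cV[F]_N, y != 0 & M *m y = 0.
Proof.
move=> acyclic M0 Mii.
pose D k := connect (fun x y => adj x y) k i.
pose M' : 'M[F]_N := \matrix_(k, j) if D k then (if D j then M k j else 0) else (k == j)%:R.
(* Transposed because [det0P] produces a row vector. *)
have det0 : \det M'^T == 0.
  rewrite det_tr (expand_det_row _ i) big1// => j _.
  rewrite mxE /D connect0; case: ifP => [ji|_]; last by rewrite mul0r.
  have [<-|ij] := eqVneq i j; first by rewrite Mii mul0r.
  rewrite M0 ?mul0r//; apply/negP => aij.
  by have := acyclic _ _ aij; rewrite ji.
have /det0P [y y0 yM] := det0.
have M'y : M' *m y^T = 0 by apply: trmx_inj; rewrite trmx_mul trmxK yM trmx0.
exists y^T; first by rewrite -trmx0 (inj_eq (@trmx_inj _ _ _)).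
have y_out k : ~~ D k -> y ord0 k = 0.
  move=> Dk; have /matrixP/(_ k ord0) := M'y; rewrite !mxE (bigD1 k)//= big1.
    by rewrite !mxE (negbTE Dk) eqxx mul1r addr0.
  by move=> j; rewrite eq_sym => /negbTE jk; rewrite !mxE (negbTE Dk) jk mul0r.
apply/matrixP => k z; rewrite (ord1 z) [RHS]mxE mxE.
(* Rows with a path to [i] agree with those of [M'] on the support of y. In any other row, an edge
   from k to a node of the support would give k a path to [i]. *)
have [Dk|Dk] := boolP (D k).
  have /matrixP/(_ k ord0) := M'y; rewrite !mxE => {2}<-; apply: eq_bigr => j _.
  rewrite !mxE Dk; case: (boolP (D j)) => // Dj.
  by rewrite y_out// !mulr0.
apply: big1 => j _; rewrite mxE.
have [Dj|Dj] := boolP (D j); last by rewrite y_out ?mulr0.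
rewrite M0 ?mul0r//.
  by apply: contraNneq Dk => ->.
apply: contraNN Dk => akj; exact: (connect_trans (connect1 akj) Dj).
Qed.

(** In a weighted sum of Lyapunov functions, the decay at j has to pay for the errors that j causes
    in all nodes i receiving from it; this inequality makes that possible. *)
Lemma dag_weights (R : realFieldType) (N : nat) (adj : 'I_N -> 'I_N -> bool) (K : R) :
    dag adj -> 0 <= K ->
  exists w : 'I_N -> R, (forall i, 1 <= w i) /\
    (forall j, K * \sum_i w i * (adj i j)%:R <= w j).
Proof.
move=> acyclic K0.
(* The weights are B ^+ h i: the factor B gained on every edge pays for K times
   the number of terms in the sum. *)
pose h j := #|[set y | connect (fun x y => adj x y) y j]|.
(* Nodes reaching i also reach j, and j itself is counted in [h j] only, since by acyclicity it does
   not reach i. *)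
have h_lt i j : adj i j -> (h i < h j)%N.
  move=> aij; apply: proper_card; apply/properP; split.
    apply/fintype.subsetP => y; rewrite !inE => yi.
    exact: connect_trans yi (connect1 aij).
  by exists j; rewrite !inE ?connect0//; exact: acyclic.
pose B := 1 + K * N%:R.
have B1 : 1 <= B by rewrite lerDl mulr_ge0.
exists (fun i => B ^+ h i); split; first by move=> i; rewrite exprn_ege1.
move=> j.
have [|] := boolP [exists i, adj i j]; last first.
  rewrite negb_exists => /forallP nadj; rewrite big1 ?mulr0 ?exprn_ge0 ?(le_trans ler01)//.
  by move=> i _; rewrite (negbTE (nadj i)) mulr0.
case/existsP => i0 /h_lt hj.
have hjE : h j = (h j).-1.+1 by rewrite prednK// (leq_ltn_trans _ hj).
have Bh0 : 0 <= B ^+ (h j).-1 by rewrite exprn_ge0// (le_trans ler01).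
apply: (@le_trans _ _ (K * \sum_(i < N) B ^+ (h j).-1)).
  rewrite ler_wpM2l//; apply: ler_sum => i _.
  case: (boolP (adj i j)) => [/h_lt hij|_]; last by rewrite mulr0.
  by rewrite mulr1 ler_weXn2l// -ltnS -hjE.
rewrite sumr_const card_ord -[X in K * X]mulr_natl mulrA {2}hjE exprS ler_wpM2r//.
by rewrite lerDr.
Qed.

(** * Rows and eigenvectors of the closed-loop matrix *)

Section platoon_rows.
Variables (R : realType) (N : nat) (adj : 'I_N -> 'I_N -> bool) (pin : 'I_N -> bool).
Variables (tau kp kv ka : 'I_N -> R) (cp cv ca : bool).

Definition pos_idx (i : 'I_N) : 'I_(N + (N + N)) := lshift (N + N) i.
Definition vel_idx (i : 'I_N) : 'I_(N + (N + N)) := rshift N (lshift N i).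
Definition acc_idx (i : 'I_N) : 'I_(N + (N + N)) := rshift N (rshift N i).

Lemma sum_idx (S : nmodType) (F : 'I_(N + (N + N)) -> S) :
  \sum_j F j = \sum_i F (pos_idx i) + (\sum_i F (vel_idx i) + \sum_i F (acc_idx i)).
Proof. by rewrite big_split_ord big_split_ord. Qed.

Lemma idxP (P : 'I_(N + (N + N)) -> Prop) :
  (forall i, P (pos_idx i)) -> (forall i, P (vel_idx i)) -> (forall i, P (acc_idx i)) ->
  forall k, P k.
Proof.
move=> Hp Hv Ha k; case: (split_ordP k) => [i ->|k' ->]; first exact: Hp.
by case: (split_ordP k') => [i ->|i ->]; [exact: Hv|exact: Ha].
Qed.

(** This is the diagonal entry of G when node i has no loop. *)
Definition gain (i : 'I_N) : R := deg R adj i + (pin i)%:R.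

Lemma Gmx_sum (S : pzRingType) (f : {rmorphism R -> S}) (y : 'I_N -> S) (i : 'I_N) :
  \sum_j f (Gmx R adj pin i j) * y j =
  f (gain i) * y i - \sum_j (adj i j)%:R * y j.
Proof.
transitivity (\sum_j ((if j == i then f (gain i) * y i else 0) - (adj i j)%:R * y j)).
  apply: eq_bigr => j _; rewrite !mxE eq_sym; have [->|ij] := eqVneq j i.
    by rewrite /gain !mulr1n addrAC rmorphB rmorph_nat mulrBl.
  by rewrite !mulr0n addr0 !sub0r rmorphN rmorph_nat mulNr.
by rewrite big_split/= sumrN -big_mkcond big_pred1_eq.
Qed.

(** The morphism [f] lets one computation serve over the reals, for solutions, and over the complex
    numbers, for eigenvectors. *)
Lemma platoon_sum (S : comPzRingType) (f : {rmorphism R -> S})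
    (w : 'I_(N + (N + N)) -> S) (i : 'I_N) :
  let A := platoon_mx adj pin tau kp kv ka cp cv ca in
  [/\ \sum_j f (A (pos_idx i) j) * w j = w (vel_idx i),
      \sum_j f (A (vel_idx i) j) * w j = w (acc_idx i) &
      \sum_j f (A (acc_idx i) j) * w j = - f (tau i)^-1 * w (acc_idx i)
        - \sum_j f (Gmx R adj pin i j) *
           (f ((tau i)^-1 * kp i * cp%:R) * w (pos_idx j)
           + f ((tau i)^-1 * kv i * cv%:R) * w (vel_idx j)
           + f ((tau i)^-1 * ka i * ca%:R) * w (acc_idx j))].
Proof.
have dsum (g : 'I_N -> S) : \sum_j f ((i == j)%:R) * g j = g i.
  rewrite (bigD1 i)//= eqxx rmorph1 mul1r big1 ?addr0// => j.
  by rewrite eq_sym => /negbTE ->; rewrite rmorph0 mul0r.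
have zsum (g : 'I_N -> S) : \sum_j f 0 * g j = 0.
  by rewrite big1// => j _; rewrite rmorph0 mul0r.
rewrite /=; split.
- rewrite sum_idx.
  under eq_bigr do rewrite /platoon_mx col_mxEu row_mxEl mxE.
  under [X in _ + (X + _)]eq_bigr do rewrite /platoon_mx col_mxEu row_mxEr row_mxEl mxE.
  under [X in _ + (_ + X)]eq_bigr do rewrite /platoon_mx col_mxEu row_mxEr row_mxEr mxE.
  by rewrite !zsum dsum add0r addr0.
- rewrite sum_idx.
  under eq_bigr do rewrite /platoon_mx col_mxEd col_mxEu row_mxEl mxE.
  under [X in _ + (X + _)]eq_bigr do rewrite /platoon_mx col_mxEd col_mxEu row_mxEr row_mxEl mxE.
  under [X in _ + (_ + X)]eq_bigr do rewrite /platoon_mx col_mxEd col_mxEu row_mxEr row_mxEr mxE.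
  by rewrite !zsum dsum !add0r.
- have TG (t : 'I_N -> R) c (j : 'I_N) : (Tmx tau t c *m Gmx R adj pin) i j =
      (tau i)^-1 * t i * c%:R * Gmx R adj pin i j.
    by rewrite /Tmx mul_diag_mx mxE mxE.
  set A := platoon_mx _ _ _ _ _ _ _ _ _; set G := Gmx R adj pin.
  have Ep j : A (acc_idx i) (pos_idx j) = - ((tau i)^-1 * kp i * cp%:R * G i j).
    by rewrite /A /platoon_mx !col_mxEd row_mxEl mxE TG.
  have Ev j : A (acc_idx i) (vel_idx j) = - ((tau i)^-1 * kv i * cv%:R * G i j).
    by rewrite /A /platoon_mx !col_mxEd row_mxEr row_mxEl mxE TG.
  have Ea j : A (acc_idx i) (acc_idx j) =
      - ((tau i)^-1 * (i == j)%:R) - (tau i)^-1 * ka i * ca%:R * G i j.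
    rewrite /A /platoon_mx !col_mxEd row_mxEr row_mxEr mxE [X in _ + X]mxE TG.
    by congr (_ - _); rewrite mulr_natr !mxE.
  (* Writing the diagonal term as a sum over j reduces the identity to a comparison term by term. *)
  rewrite sum_idx -(dsum (fun j => - f (tau i)^-1 * w (acc_idx j))).
  rewrite -sumrB -!big_split/=; apply: eq_bigr => j _.
  by rewrite Ep Ev Ea !(rmorphB, rmorphN, rmorphM)/=; ring.
Qed.

End platoon_rows.

(** The first two block rows force an eigenvector to be (y, l y, l^2 y); the third then says that y
    is in the kernel of a matrix polynomial in l. Its i-th diagonal entry is the cubic, so
    [dag_kernel] gives y. *)
Lemma platoon_eigenvector (R : realType) (N : nat) (adj : 'I_N -> 'I_N -> bool)
    (pin : 'I_N -> bool) (tau kp kv ka : 'I_N -> R) (cp cv ca : bool)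
    (i : 'I_N) (l : R[i]) :
    dag adj ->
    l ^+ 3 + ((tau i)^-1 + (tau i)^-1 * ka i * ca%:R * gain R adj pin i)%:C * l ^+ 2
      + ((tau i)^-1 * kv i * cv%:R * gain R adj pin i)%:C * l
      + ((tau i)^-1 * kp i * cp%:R * gain R adj pin i)%:C = 0 ->
  exists2 v : 'I_(N + (N + N)) -> R[i],
    forall k, \sum_j (platoon_mx adj pin tau kp kv ka cp cv ca k j)%:C * v j = l * v k
    & exists k, v k != 0.
Proof.
move=> acyclic root_l.
have adjii : adj i i = false.
  by apply/negP => aii; have := acyclic _ _ aii; rewrite connect0.
(* With Q the diagonal matrix of the [q k], [M] below is l^3 I + l^2 Delta + Q G. *)
pose q k := ((tau k)^-1 * kp k * cp%:R)%:C + ((tau k)^-1 * kv k * cv%:R)%:C * l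
  + ((tau k)^-1 * ka k * ca%:R)%:C * l ^+ 2.
pose M : 'M[R[i]]_N := \matrix_(k, j)
  ((k == j)%:R * (l ^+ 3 + ((tau k)^-1)%:C * l ^+ 2) + (Gmx R adj pin k j)%:C * q k).
have [||y y0 My] := @dag_kernel _ _ adj M i acyclic.
- move=> k j kj akj; rewrite !mxE (negbTE kj) (negbTE akj) !mulr0n addr0 subr0.
  by rewrite rmorph0 !mul0r addr0.
- rewrite !mxE eqxx adjii !mulr1n subr0 mul1r -/(gain R adj pin i) -[RHS]root_l.
  by rewrite /q !(rmorphD, rmorphM)/=; ring.
pose v k := col_mx y (col_mx (l *: y) (l ^+ 2 *: y)) k ord0.
have vp j : v (pos_idx j) = y j ord0 by rewrite /v col_mxEu.
have vv j : v (vel_idx j) = l * y j ord0 by rewrite /v col_mxEd col_mxEu mxE.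
have va j : v (acc_idx j) = l ^+ 2 * y j ord0 by rewrite /v !col_mxEd mxE.
exists v; last first.
  have [j yj] : exists j, y j ord0 != 0.
    apply/existsP; apply: contraNT y0; rewrite negb_exists => /forallP y0.
    apply/eqP/matrixP => j z; rewrite (ord1 z) mxE.
    by have := y0 j; rewrite negbK => /eqP.
  by exists (pos_idx j); rewrite vp.
have rows k := platoon_sum adj pin tau kp kv ka cp cv ca (real_complex R) v k.
apply: idxP => k; have [Hp Hv Ha] := rows k.
- by rewrite Hp vv vp.
- by rewrite Hv vv va; ring.
have : (M *m y) k ord0 = 0 by rewrite My mxE.
have -> : (M *m y) k ord0 = (l ^+ 3 + ((tau k)^-1)%:C * l ^+ 2) * y k ord0
    + \sum_j (Gmx R adj pin k j)%:C * (q k * y j ord0).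
  rewrite mxE (eq_bigr (fun j => (k == j)%:R * ((l ^+ 3 + ((tau k)^-1)%:C * l ^+ 2)
      * y j ord0) + (Gmx R adj pin k j)%:C * (q k * y j ord0))); last first.
    by move=> j _; rewrite mxE; ring.
  rewrite big_split/=; congr (_ + _); rewrite (bigD1 k)//= eqxx mul1r big1 ?addr0//.
  by move=> j; rewrite eq_sym => /negbTE ->; rewrite mul0r.
move=> /eqP; rewrite addr_eq0 => /eqP H.
rewrite Ha va; under eq_bigr do rewrite vp vv va.
have -> : \sum_j (Gmx R adj pin k j)%:C *
  (((tau k)^-1 * kp k * cp%:R)%:C * y j ord0 +
   ((tau k)^-1 * kv k * cv%:R)%:C * (l * y j ord0) +
   ((tau k)^-1 * ka k * ca%:R)%:C * (l ^+ 2 * y j ord0)) =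
  \sum_j (Gmx R adj pin k j)%:C * (q k * y j ord0).
  by apply: eq_bigr => j _; rewrite /q; ring.
by rewrite -[X in _ - X]opprK -H; ring.
Qed.

(** * Exponential decay of the cascade *)

Lemma sqr_sum_le (R : realDomainType) (n : nat) (f : 'I_n -> R) :
  (\sum_i f i) ^+ 2 <= 2 ^+ n * \sum_i f i ^+ 2.
Proof.
elim: n f => [|n IHn] f; first by rewrite !big_ord0 expr0n mulr0.
rewrite !big_ord_recr/= [2 ^+ n.+1]exprS.
set s := \sum_(i < n) f _; set x := f ord_max.
apply: (@le_trans _ _ (2 * (s ^+ 2 + x ^+ 2))).
  by have := sqr_ge0 (s - x); lra.
rewrite -mulrA ler_wpM2l// mulrDr lerD ?IHn//.
by rewrite ler_peMl ?sqr_ge0// exprn_ege1// ler1n.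
Qed.

Lemma exists_lower_bound (R : realFieldType) (n : nat) (f : 'I_n -> R) :
  (forall i, 0 < f i) -> exists2 m, 0 < m & forall i, m <= f i.
Proof.
(* Starting the minimum at 1 keeps it positive when there is no index. *)
move=> f0; exists (\big[Num.min/1]_i f i); last by move=> i; exact: bigmin_le.
by apply: lt_bigmin.
Qed.

Lemma exists_upper_bound (R : realFieldType) (n : nat) (f : 'I_n -> R) :
  exists2 m, 0 < m & forall i, f i <= m.
Proof.
exists (1 + \sum_i `|f i|).
  by rewrite ltr_pwDl// sumr_ge0.
move=> i; rewrite (bigD1 i)//= addrCA (le_trans (ler_norm _))// lerDl.
by rewrite addr_ge0// sumr_ge0.
Qed.

(** Stated for families of scalar functions, so that only the cascade structure enters; [tp], [tv],
    [ta] are the coupling gains. *)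
Lemma cascade_decay (R : realType) (N : nat) (adj : 'I_N -> 'I_N -> bool)
    (a b c tp tv ta : 'I_N -> R) :
    dag adj -> (forall i, [/\ 0 < a i, 0 < c i & c i < a i * b i]) ->
  exists C beta, [/\ 0 < C, 0 < beta & forall x y z : 'I_N -> R -> R,
    (forall i t, is_derive t (1 : R) (x i) (y i t)) ->
    (forall i t, is_derive t (1 : R) (y i) (z i t)) ->
    (forall i t, is_derive t (1 : R) (z i)
      (- c i * x i t - b i * y i t - a i * z i t
       + \sum_j (adj i j)%:R * (tp i * x j t + tv i * y j t + ta i * z j t))) ->
    forall t, 0 <= t -> forall i,
      x i t ^+ 2 + y i t ^+ 2 + z i t ^+ 2 <=
      C * (\sum_j (x j 0 ^+ 2 + y j 0 ^+ 2 + z j 0 ^+ 2)) * expR (- (beta * t))].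
Proof.
move=> acyclic stab.
(* The constants of a node are packed in a tuple for a single use of choice; all but [e] are then
   replaced by constants common to all nodes. *)
have /choice[P HP] : forall i, exists P : R * R * R * R * R,
    let: (e, m, M, al, K) := P in
    [/\ 0 < m, 0 <= M, 0 < al, 0 <= K & forall x y z u,
   let S := x ^+ 2 + y ^+ 2 + z ^+ 2 in
   [/\ m * S <= lyap (a i) (b i) (c i) e x y z, lyap (a i) (b i) (c i) e x y z <= M * S &
       dlyap (a i) (b i) (c i) e x y z u <= - al * S + K * u ^+ 2]].
  move=> i; have [a0 c0 abc] := stab i.
  by have [e [m [M [al [K H]]]]] := lyap_exists a0 c0 abc; exists (e, m, M, al, K).
pose e i := (P i).1.1.1.1; pose W i := lyap (a i) (b i) (c i) (e i).
pose dW i := dlyap (a i) (b i) (c i) (e i).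
have [m m0 Wge] : exists2 m, 0 < m & forall i x y z,
    m * (x ^+ 2 + y ^+ 2 + z ^+ 2) <= W i x y z.
  have [|m m0 mle] := @exists_lower_bound R N (fun i => (P i).1.1.1.2).
    by move=> i; have := HP i; case: (P i) => [[[[? ?] ?] ?] ?] [].
  exists m => // i x y z; apply: le_trans (ler_wpM2r _ (mle i)) _.
    by rewrite !addr_ge0 ?sqr_ge0.
  rewrite /W /e; have := HP i; case: (P i) => [[[[? ?] ?] ?] ?] [_ _ _ _ H].
  by have [] := H x y z 0.
have W0 i x y z : 0 <= W i x y z.
  apply: le_trans (Wge i x y z); rewrite mulr_ge0 ?(ltW m0)//.
  by rewrite !addr_ge0 ?sqr_ge0.
have [M M0 Wle] : exists2 M, 0 < M & forall i x y z,
    W i x y z <= M * (x ^+ 2 + y ^+ 2 + z ^+ 2).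
  have [M M0 Mge] := @exists_upper_bound R N (fun i => (P i).1.1.2).
  exists M => // i x y z; apply: le_trans (ler_wpM2r _ (Mge i)); last first.
    by rewrite !addr_ge0 ?sqr_ge0.
  rewrite /W /e; have := HP i; case: (P i) => [[[[? ?] ?] ?] ?] [_ _ _ _ H].
  by have [] := H x y z 0.
have [al al0 [K K0 dWle]] : exists2 al, 0 < al & exists2 K, 0 < K & forall i x y z u,
    dW i x y z u <= - al * (x ^+ 2 + y ^+ 2 + z ^+ 2) + K * u ^+ 2.
  have [|al al0 alle] := @exists_lower_bound R N (fun i => (P i).1.2).
    by move=> i; have := HP i; case: (P i) => [[[[? ?] ?] ?] ?] [].
  have [K K0 Kge] := @exists_upper_bound R N (fun i => (P i).2).
  exists al => //; exists K => // i x y z u.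
  apply: (@le_trans _ _ (- (P i).1.2 * (x ^+ 2 + y ^+ 2 + z ^+ 2) + (P i).2 * u ^+ 2)).
    rewrite /dW /e; have := HP i; case: (P i) => [[[[? ?] ?] ?] ?] [_ _ _ _ H].
    by have [] := H x y z u.
  by rewrite lerD ?ler_wpM2r ?sqr_ge0 ?lerN2// !addr_ge0 ?sqr_ge0.
(* Cauchy-Schwarz for the coupling terms, by Lagrange's identity. *)
have [L L0 Lge] := exists_upper_bound (fun i => tp i ^+ 2 + tv i ^+ 2 + ta i ^+ 2).
have uE i (x y z : R) : (tp i * x + tv i * y + ta i * z) ^+ 2 <=
    L * (x ^+ 2 + y ^+ 2 + z ^+ 2).
  apply: le_trans (ler_wpM2r _ (Lge i)); last by rewrite !addr_ge0 ?sqr_ge0.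
  rewrite -subr_ge0.
  have -> : (tp i ^+ 2 + tv i ^+ 2 + ta i ^+ 2) * (x ^+ 2 + y ^+ 2 + z ^+ 2)
      - (tp i * x + tv i * y + ta i * z) ^+ 2
    = (tp i * y - tv i * x) ^+ 2 + (tp i * z - ta i * x) ^+ 2
      + (tv i * z - ta i * y) ^+ 2 by ring.
  by rewrite !addr_ge0 ?sqr_ge0.
pose Q := K * (2 ^+ N * L).
have Q0 : 0 < Q by rewrite !mulr_gt0 ?exprn_gt0.
(* The factor 2 Q / al makes the error terms consume at most half of the decay. *)
have [w [w1 wQ]] : exists w : 'I_N -> R, (forall i, 1 <= w i) /\
    (forall j, 2 * Q / al * \sum_i w i * (adj i j)%:R <= w j).
  by apply: dag_weights => //; rewrite divr_ge0 ?mulr_ge0 ?ltW.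
have w0 i : 0 <= w i by rewrite (le_trans ler01).
have [wm wm0 wle] := exists_upper_bound w.
(* The remaining decay al / 2 of the weighted sum of S_j is compared with V through V <= M sum w_j
   S_j. The constant combines m S_i <= V, as weights are at least 1, with V(0) <= wm M sum
   S_j(0). *)
exists (wm * M / m), (al / (2 * M)); split; rewrite ?divr_gt0 ?mulr_gt0//.
move=> x y z dx dy dz t t0 i.
pose S j s := x j s ^+ 2 + y j s ^+ 2 + z j s ^+ 2.
have S0 j s : 0 <= S j s by rewrite !addr_ge0 ?sqr_ge0.
pose u j s := \sum_k (adj j k)%:R * (tp j * x k s + tv j * y k s + ta j * z k s).
pose V s := \sum_j w j * W j (x j s) (y j s) (z j s).
have u2 j s : u j s ^+ 2 <= 2 ^+ N * L * \sum_k (adj j k)%:R * S k s.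
  apply: le_trans (sqr_sum_le _) _; rewrite -mulrA ler_wpM2l ?exprn_ge0//.
  rewrite mulr_sumr; apply: ler_sum => k _.
  case: (adj j k); last by rewrite !mul0r expr0n mulr0.
  by rewrite !mul1r; exact: uE.
have dV s : is_derive s (1 : R) V
    (\sum_j w j * dW j (x j s) (y j s) (z j s) (u j s)).
  have -> : V = \sum_j (fun s => w j * W j (x j s) (y j s) (z j s)).
    by apply/funext => r; rewrite fct_sumE.
  apply: is_derive_sum => j; apply: is_derive_mulc; exact: is_derive_lyap.
have dVle s : \sum_j w j * dW j (x j s) (y j s) (z j s) (u j s) <= - (al / (2 * M)) * V s.
  apply: (@le_trans _ _ (- (al / 2) * \sum_j w j * S j s)); last first.
    have VS : V s <= M * \sum_j w j * S j s.
      rewrite mulr_sumr; apply: ler_sum => j _.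
      by rewrite mulrCA ler_wpM2l//; exact: Wle.
    rewrite !mulNr lerN2.
    have -> : al / (2 * M) = al / 2 / M by field; lra.
    rewrite -[X in X <= _]mulrA ler_wpM2l ?divr_ge0 ?(ltW al0)//.
    by rewrite mulrC ler_pdivrMr// mulrC.
  (* Exchanging the sums collects the errors by their source k, where the weight inequality
     applies. *)
  have step : \sum_j w j * (Q * \sum_k (adj j k)%:R * S k s) <= al / 2 * \sum_j w j * S j s.
    have -> : \sum_j w j * (Q * \sum_k (adj j k)%:R * S k s)
        = \sum_k (Q * \sum_j w j * (adj j k)%:R) * S k s.
      under eq_bigr do rewrite mulrCA !mulr_sumr.
      rewrite exchange_big/=; apply: eq_bigr => k _.
      rewrite mulr_sumr mulr_suml; apply: eq_bigr => j _; ring.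
    rewrite mulr_sumr; apply: ler_sum => k _; rewrite mulrA ler_wpM2r//.
    have := wQ k; set sg := \sum_j _ => H.
    have -> : Q * sg = al / 2 * (2 * Q / al * sg) by field; lra.
    by rewrite ler_wpM2l// divr_ge0// ltW.
  apply: (@le_trans _ _ (\sum_j (- al * (w j * S j s)
      + w j * (Q * \sum_k (adj j k)%:R * S k s)))).
    apply: ler_sum => j _.
    have -> : - al * (w j * S j s) + w j * (Q * \sum_k (adj j k)%:R * S k s)
      = w j * (- al * S j s + Q * \sum_k (adj j k)%:R * S k s) by ring.
    rewrite ler_wpM2l//; apply: le_trans (dWle _ _ _ _ _) _.
    by rewrite lerD// -mulrA ler_wpM2l// ltW.
  rewrite big_split/= -mulr_sumr; move: step.
  set s1 := \sum_j w j * S j s; lra.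
have := gronwall_le0 dV dVle t0.
have V0le : V 0 <= wm * M * \sum_j S j 0.
  rewrite mulr_sumr; apply: ler_sum => j _; rewrite -mulrA.
  by apply: ler_pM.
have Vge : m * S i t <= V t.
  rewrite /V (bigD1 i)//= -[X in X <= _]addr0 lerD//.
    by apply: (le_trans (Wge i (x i t) (y i t) (z i t))); rewrite ler_peMl.
  by apply: sumr_ge0 => j _; rewrite mulr_ge0.
move=> Vt; rewrite -/(S i t).
have -> : wm * M / m * (\sum_j S j 0) * expR (- (al / (2 * M) * t))
  = (wm * M * (\sum_j S j 0) * expR (- (al / (2 * M) * t))) / m by ring.
by rewrite ler_pdivlMr// mulrC (le_trans Vge)// (le_trans Vt)// ler_wpM2r// expR_ge0.
Qed.

(** * Routh-Hurwitz conditions in terms of the gains, and the equivalence *)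

(** With D = 1 + ka ca g, the first inequality is D > 0, and cancelling g / tau^2 in the last gives
    tau kp < D kv. A zero indicator or g = 0 would contradict 0 < c < a b. *)
Lemma routh_hurwitz_platoon (R : realFieldType) (tau kp kv ka g : R) (cp cv ca : bool) :
    0 < tau -> 0 <= g ->
  ([/\ 0 < tau^-1 + tau^-1 * ka * ca%:R * g, 0 < tau^-1 * kp * cp%:R * g &
      tau^-1 * kp * cp%:R * g <
        (tau^-1 + tau^-1 * ka * ca%:R * g) * (tau^-1 * kv * cv%:R * g)] <->
   [/\ cp = true /\ cv = true, 0 < g, 0 < kp, 
     tau * kp / (1 + ka * ca%:R * g) < kv & - g^-1 < ka * ca%:R]).
Proof.
move=> tau0 g0.
have ti0 : 0 < tau^-1 by rewrite invr_gt0.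
have aE : tau^-1 + tau^-1 * ka * ca%:R * g = tau^-1 * (1 + ka * ca%:R * g) by ring.
rewrite aE; set D := 1 + ka * ca%:R * g.
have gE (k : R) : 0 < g -> (- g^-1 < k) = (0 < 1 + k * g).
  by move=> gP; rewrite -(ltr_pM2r gP) mulNr mulVf ?gt_eqF// -subr_gt0 opprK addrC.
split.
  case; rewrite pmulr_rgt0// => D0.
  case: cp => /=; last by rewrite mulr0 mul0r ltxx.
  rewrite mulr1 => kpg; have gP : 0 < g.
    rewrite lt_neqAle g0 andbT; apply: contraTneq kpg => <-.
    by rewrite mulr0 ltxx.
  have kp0 : 0 < kp by move: kpg; rewrite pmulr_lgt0// pmulr_rgt0.
  case: cv => /=; last first.
    by rewrite !(mulr0, mul0r) => /(lt_trans kpg); rewrite ltxx.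
  rewrite mulr1 => H; split => //.
    rewrite ltr_pdivrMr// -(ltr_pM2l ti0) -(ltr_pM2l ti0) -(ltr_pM2r gP).
    have -> : tau^-1 * (tau^-1 * (tau * kp)) * g = tau^-1 * kp * g by field; lra.
    by apply: lt_le_trans H _; rewrite le_eqVlt; apply/orP; left; apply/eqP; ring.
  by rewrite gE.
case=> -[-> ->] gP kp0 H; rewrite gE// -/D => D0.
rewrite !mulr1; split; [exact: mulr_gt0|by rewrite !mulr_gt0|].
move: H; rewrite ltr_pdivrMr// -(ltr_pM2l ti0) -(ltr_pM2l ti0) -(ltr_pM2r gP).
have -> : tau^-1 * (tau^-1 * (tau * kp)) * g = tau^-1 * kp * g by field; lra.
move=> H; apply: lt_le_trans H _.
by rewrite le_eqVlt; apply/orP; left; apply/eqP; ring.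
Qed.

Theorem theorem2 (R : realType) (N : nat) (HN : (0 < N)%N)
  (adj : 'I_N -> 'I_N -> bool) (pin : 'I_N -> bool)
  (tau kp kv ka : 'I_N -> R) (cp cv ca : bool)
  (Htau : forall i, 0 < tau i)
  (Hdag : dag adj) :
  asympt_stable (platoon_mx adj pin tau kp kv ka cp cv ca) <->
  [/\ cp = true /\ cv = true,
      (forall i, 0 < deg R adj i + (pin i)%:R) &
      (forall i, let dp := deg R adj i + (pin i)%:R in
         [/\ 0 < kp i,
             tau i * kp i / (1 + ka i * (ca%:R) * dp) < kv i &
             - (dp^-1) < ka i * ca%:R])].
Proof.
have gain0 i : 0 <= gain R adj pin i.
  by rewrite addr_ge0// sumr_ge0.
have RH i := routh_hurwitz_platoon (kp i) (kv i) (ka i) cp cv ca (Htau i) (gain0 i).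
split.
  move=> [_ attr].
  have cond i := (RH i).1 (hurwitz_of_roots (fun z rz =>
    let: ex_intro2 v Av v0 := platoon_eigenvector Hdag rz in eigenvalue_Re_lt0 attr Av v0)).
  (* The indicators do not depend on the node, so any one node, here that of index 0, determines
     them. *)
  by split=> [|i|i]; [case: (cond (Ordinal HN))|case: (cond i)|case: (cond i)].
move=> [ctrue gpos cond].
pose t (k : 'I_N -> R) (s : bool) i := (tau i)^-1 * k i * s%:R.
have stab i : [/\ 0 < (tau i)^-1 + t ka ca i * gain R adj pin i,
    0 < t kp cp i * gain R adj pin i & t kp cp i * gain R adj pin i <
    ((tau i)^-1 + t ka ca i * gain R adj pin i) * (t kv cv i * gain R adj pin i)].
  by apply: (RH i).2; have [? ? ?] := cond i; split => //; exact: gpos.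
have [C [beta [C0 beta0 H]]] := cascade_decay (t kp cp) (t kv cv) (t ka ca) Hdag stab.
apply: (asympt_stable_exp C0 beta0) => x solx s s0.
have rows r i := platoon_sum adj pin tau kp kv ka cp cv ca idfun (fun k => x r k ord0) i.
have {}H := H (fun i r => x r (pos_idx i) ord0) (fun i r => x r (vel_idx i) ord0)
  (fun i r => x r (acc_idx i) ord0) _ _ _ s s0.
have bound i : x s (pos_idx i) ord0 ^+ 2 + x s (vel_idx i) ord0 ^+ 2
    + x s (acc_idx i) ord0 ^+ 2 <=
    C * (\sum_j x 0 j ord0 ^+ 2) * expR (- (beta * s)).
  rewrite sum_idx -!big_split/=.
  under eq_bigr do rewrite addrA.
  apply: H => j r.
  - by apply: (is_derive_eq (solx r (pos_idx j))); rewrite mxE; have [] := rows r j.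
  - by apply: (is_derive_eq (solx r (vel_idx j))); rewrite mxE; have [] := rows r j.
  (* [Gmx_sum] separates the diagonal part, which gives the cubic's coefficients, from the input of
     the predecessors. *)
  - apply: (is_derive_eq (solx r (acc_idx j))); rewrite mxE; have [_ _ ->] := rows r j.
    rewrite (Gmx_sum adj pin idfun)/= /t; ring.
apply: idxP => i; apply: le_trans (bound i).
- by rewrite -addrA lerDl addr_ge0 ?sqr_ge0.
- by rewrite addrAC lerDr addr_ge0 ?sqr_ge0.
- by rewrite lerDr addr_ge0 ?sqr_ge0.
Qed.
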